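(* Let $\alpha,\beta$ be positive constants, $\alpha\neq\beta$, let $J\subset\mathbb{R}$ be an open interval, and let $f,g:J\to\mathbb{R}$ be smooth functions with $f'^2-g'^2<0$ and $\alpha^2f^2+\beta^2g^2>0$ on $J$. The timelike rotational surface of Moore type $$\mathcal{M}_2:\ z(u,v)=\bigl(f(u)\cos\alpha v,\ f(u)\sin\alpha v,\ g(u)\sinh\beta v,\ g(u)\cosh\beta v\bigr),\qquad u\in J,\ v\in[0;2\pi),$$ in $\mathbb{R}^4_1$ has zero mean curvature if and only if its meridian curve is given by the formula $$f=\frac{\sqrt{A}}{\alpha}\,\sin\left(\frac{\varepsilon\alpha}{\beta}\ln\left|\beta g+\sqrt{\beta^2g^2+A}\right|+C\right),$$ where $A$ is a positive constant, $C$ is a constant and $\varepsilon=\pm1$.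
   Context: $\mathbb{R}^4_1$ is Minkowski 4-space, i.e. $\mathbb{R}^4$ with the flat metric $\langle\,,\rangle = dx_1^2+dx_2^2+dx_3^2-dx_4^2$. The surface $\mathcal{M}_2$ is obtained by a general rotation of the timelike meridian curve $u\mapsto(f(u),0,0,g(u))$ lying in the Lorentz plane $Oe_1e_4$. Its first fundamental form has coefficients $E=f'^2-g'^2<0$, $F=0$, $G=\alpha^2f^2+\beta^2g^2>0$, so it is timelike (induced metric of signature $(1,1)$). With $\sigma$ the second fundamental tensor (normal component of the flat connection), the mean curvature vector is $H=\frac12(-\sigma(x,x)+\sigma(y,y))$ for an orthonormal tangent frame with $\langle x,x\rangle=-1$, $\langle y,y\rangle=1$; ''zero mean curvature'' means $H=0$ at every point.
   Formalization: The formal theorem also assumes that f is not identically zero on J: if f = 0 the surface lies in the Lorentz plane x1 = x2 = 0 and has H = 0, yet the formula with A > 0 cannot give f = 0, so the equivalence fails there. *)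

(* Defs.v *)
From Stdlib Require Import Reals Lra.
From Coquelicot Require Import Coquelicot.
Open Scope R_scope.

Definition R4 : Type := (R * R * R * R)%type.

Definition x1 (p : R4) : R := fst (fst (fst p)).
Definition x2 (p : R4) : R := snd (fst (fst p)).
Definition x3 (p : R4) : R := snd (fst p).
Definition x4 (p : R4) : R := snd p.

Definition minkowski (p q : R4) : R :=
  x1 p * x1 q + x2 p * x2 q + x3 p * x3 q - x4 p * x4 q.

Definition partial_u (z : R -> R -> R4) (u v : R) : R4 :=
  (Derive (fun s => x1 (z s v)) u, Derive (fun s => x2 (z s v)) u,
   Derive (fun s => x3 (z s v)) u, Derive (fun s => x4 (z s v)) u).

Definition partial_v (z : R -> R -> R4) (u v : R) : R4 :=
  (Derive (fun t => x1 (z u t)) v, Derive (fun t => x2 (z u t)) v,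
   Derive (fun t => x3 (z u t)) v, Derive (fun t => x4 (z u t)) v).

Definition coefE (z : R -> R -> R4) (u v : R) : R :=
  minkowski (partial_u z u v) (partial_u z u v).
Definition coefF (z : R -> R -> R4) (u v : R) : R :=
  minkowski (partial_u z u v) (partial_v z u v).
Definition coefG (z : R -> R -> R4) (u v : R) : R :=
  minkowski (partial_v z u v) (partial_v z u v).

(* Tangent vectors are given by their coordinates [X : R * R] in the basis
   (z_u, z_v); for fixed [X] this is also a tangent field along the surface. *)
Definition tangent (z : R -> R -> R4) (X : R * R) (u v : R) : R4 :=
  plus (scal (fst X) (partial_u z u v)) (scal (snd X) (partial_v z u v)).

(* The component of [w] normal to the tangent plane, obtained by solving the
   2x2 Gram system for the tangential component; meaningful when
   EG - F^2 <> 0, see [normal_component_spec]. *)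
Definition normal_component (z : R -> R -> R4) (u v : R) (w : R4) : R4 :=
  let E := coefE z u v in let F := coefF z u v in let G := coefG z u v in
  let p := minkowski w (partial_u z u v) in
  let q := minkowski w (partial_v z u v) in
  minus w (tangent z ((G * p - F * q) / (E * G - F ^ 2),
                      (E * q - F * p) / (E * G - F ^ 2)) u v).

Lemma normal_component_spec (z : R -> R -> R4) (u v : R) (w : R4) :
  coefE z u v * coefG z u v - coefF z u v ^ 2 <> 0 ->
  (forall X, minkowski (normal_component z u v w) (tangent z X u v) = 0) /\
  exists X, w = plus (normal_component z u v w) (tangent z X u v).
Proof.
  intros h; split.
  - intros [a b].
    assert (lin : forall p q r c d : R4, forall k l : R,
      minkowski (minus p (plus (scal k c) (scal l d)))
                (plus (scal a q) (scal b r)) =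
      a * (minkowski p q - k * minkowski c q - l * minkowski d q) +
      b * (minkowski p r - k * minkowski c r - l * minkowski d r)).
    { intros [[[? ?] ?] ?] [[[? ?] ?] ?] [[[? ?] ?] ?] [[[? ?] ?] ?]
        [[[? ?] ?] ?] k l.
      unfold minkowski, minus, plus, scal, opp, x1, x2, x3, x4; simpl.
      unfold minus, plus, scal, opp, mult; simpl; unfold mult; simpl; ring. }
    assert (sym : forall p q, minkowski p q = minkowski q p)
      by (intros; unfold minkowski; ring).
    unfold normal_component, tangent; simpl fst; simpl snd.
    rewrite lin, (sym (partial_v z u v) (partial_u z u v)).
    fold (coefE z u v) (coefF z u v) (coefG z u v).
    field; intros e; apply h; rewrite <- e; ring.
  - unfold normal_component; eexists.
    assert (sub_add : forall p t : R4, p = plus (minus p t) t).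
    { intros p t; unfold minus; rewrite <- plus_assoc.
      change (p = plus p (plus (opp t) t)).
      rewrite (plus_opp_l t), plus_zero_r; reflexivity. }
    apply sub_add.
Qed.

(* D_X Y for the flat connection, [Y] being extended to the tangent field
   with constant coordinates. *)
Definition flat_derivative (z : R -> R -> R4) (u v : R) (X Y : R * R) : R4 :=
  plus (scal (fst X) (partial_u (tangent z Y) u v))
       (scal (snd X) (partial_v (tangent z Y) u v)).

(* sigma(X, Y); being tensorial, it does not depend on the extension of [Y]. *)
Definition second_fundamental
    (z : R -> R -> R4) (u v : R) (X Y : R * R) : R4 :=
  normal_component z u v (flat_derivative z u v X Y).

Definition orthonormal_frame (z : R -> R -> R4) (u v : R) (X Y : R * R) : Prop :=
  minkowski (tangent z X u v) (tangent z X u v) = -1 /\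
  minkowski (tangent z X u v) (tangent z Y u v) = 0 /\
  minkowski (tangent z Y u v) (tangent z Y u v) = 1.

(* For a timelike surface a frame exists, and all frames give the same [H]. *)
Definition is_mean_curvature_vector
    (z : R -> R -> R4) (u v : R) (H : R4) : Prop :=
  exists X Y : R * R, orthonormal_frame z u v X Y /\
    H = scal (1 / 2) (plus (opp (second_fundamental z u v X X))
                           (second_fundamental z u v Y Y)).

Definition zero_mean_curvature
    (U : R -> R -> Prop) (z : R -> R -> R4) : Prop :=
  forall u v, U u v -> is_mean_curvature_vector z u v zero.

Definition Rbar_open_interval (a b : Rbar) (u : R) : Prop :=
  Rbar_lt a u /\ Rbar_lt u b.

Definition smooth_on (J : R -> Prop) (f : R -> R) : Prop :=
  forall (n : nat) (u : R), J u -> ex_derive_n f n u.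

Definition moore_surface (alpha beta : R) (f g : R -> R) (u v : R) : R4 :=
  (f u * cos (alpha * v), f u * sin (alpha * v),
   g u * sinh (beta * v), g u * cosh (beta * v)).

(* Main.v *)
(* The surface is the orbit of its meridian under a one-parameter group of
   isometries, so H = 0 is an ODE for the meridian alone. Where the surface is
   timelike, that ODE makes
     A = (beta^2 g^2 f'^2 + alpha^2 f^2 g'^2) / (g'^2 - f'^2)
   constant, and A > 0 unless f vanishes identically. With
   w = sqrt (beta^2 g^2 + A) and t = (alpha / beta) ln (beta g + w), so that
   t' = alpha g' / w, the ODE then reads d^2 f / dt^2 = - f, with no exception
   at the zeros of f'. The first integral fixes the amplitude of the resulting
   sine to be sqrt A / alpha. *)
Require Import Defs.
From Stdlib Require Import Reals Lra.
From Coquelicot Require Import Coquelicot.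
Open Scope R_scope.

(** * Coordinates in Minkowski 4-space and linearity of the normal projection *)

Lemma R4_ext (p q : R4) :
  x1 p = x1 q -> x2 p = x2 q -> x3 p = x3 q -> x4 p = x4 q -> p = q.
Proof.
destruct p as [[[? ?] ?] ?], q as [[[? ?] ?] ?]; unfold x1, x2, x3, x4; simpl.
intros -> -> -> ->; reflexivity.
Qed.

(* [plus] and [scal] occur in the definitions through several convertible
   canonical structures, on which [rewrite] would fail. *)
Ltac R4_coords :=
  unfold minus;
  repeat match goal with
  | |- context [x1 (@plus ?G ?p ?q)] => change (x1 (@plus G p q)) with (x1 p + x1 q)
  | |- context [x1 (@scal ?K ?V ?k ?p)] => change (x1 (@scal K V k p)) with (k * x1 p)
  | |- context [x1 (@opp ?G ?p)] => change (x1 (@opp G p)) with (- x1 p)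
  | |- context [x1 (@zero ?G)] => change (x1 (@zero G)) with 0
  | |- context [x2 (@plus ?G ?p ?q)] => change (x2 (@plus G p q)) with (x2 p + x2 q)
  | |- context [x2 (@scal ?K ?V ?k ?p)] => change (x2 (@scal K V k p)) with (k * x2 p)
  | |- context [x2 (@opp ?G ?p)] => change (x2 (@opp G p)) with (- x2 p)
  | |- context [x2 (@zero ?G)] => change (x2 (@zero G)) with 0
  | |- context [x3 (@plus ?G ?p ?q)] => change (x3 (@plus G p q)) with (x3 p + x3 q)
  | |- context [x3 (@scal ?K ?V ?k ?p)] => change (x3 (@scal K V k p)) with (k * x3 p)
  | |- context [x3 (@opp ?G ?p)] => change (x3 (@opp G p)) with (- x3 p)
  | |- context [x3 (@zero ?G)] => change (x3 (@zero G)) with 0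
  | |- context [x4 (@plus ?G ?p ?q)] => change (x4 (@plus G p q)) with (x4 p + x4 q)
  | |- context [x4 (@scal ?K ?V ?k ?p)] => change (x4 (@scal K V k p)) with (k * x4 p)
  | |- context [x4 (@opp ?G ?p)] => change (x4 (@opp G p)) with (- x4 p)
  | |- context [x4 (@zero ?G)] => change (x4 (@zero G)) with 0
  end;
  cbn [x1 x2 x3 x4 fst snd].

Ltac R4_ring := apply R4_ext; R4_coords; ring.

(** Linearity lets the trace of the flat derivative be formed first, so that a single vector has to
    be projected. *)
Lemma normal_component_plus (z : R -> R -> R4) (u v : R) (p q : R4) :
  normal_component z u v (plus p q) =
  plus (normal_component z u v p) (normal_component z u v q).
Proof.
unfold normal_component, tangent.
apply R4_ext; unfold minkowski; R4_coords; unfold Rdiv; ring.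
Qed.

Lemma normal_component_opp (z : R -> R -> R4) (u v : R) (p : R4) :
  normal_component z u v (opp p) = opp (normal_component z u v p).
Proof.
unfold normal_component, tangent.
apply R4_ext; unfold minkowski; R4_coords; unfold Rdiv; ring.
Qed.

(** * The one-parameter group of isometries *)

Lemma cosh2_sinh2 (x : R) : cosh x ^ 2 - sinh x ^ 2 = 1.
Proof.
unfold cosh, sinh.
transitivity (exp x * exp (- x)); [field |].
rewrite <- exp_plus, Rplus_opp_r; apply exp_0.
Qed.

(** A Euclidean rotation by [alpha * v] in the first two coordinates together with a Lorentz boost
    of rapidity [beta * v] in the last two; the surface is the orbit of its meridian under this
    group. *)
Definition moore_rotation (alpha beta v : R) (p : R4) : R4 :=
  (x1 p * cos (alpha * v) - x2 p * sin (alpha * v),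
   x1 p * sin (alpha * v) + x2 p * cos (alpha * v),
   x3 p * cosh (beta * v) + x4 p * sinh (beta * v),
   x3 p * sinh (beta * v) + x4 p * cosh (beta * v)).

Lemma moore_rotation_isometry (alpha beta v : R) (p q : R4) :
  minkowski (moore_rotation alpha beta v p) (moore_rotation alpha beta v q) = minkowski p q.
Proof.
pose proof (cosh2_sinh2 (beta * v)) as hc.
pose proof (sin2_cos2 (alpha * v)) as ht; unfold Rsqr in ht.
unfold moore_rotation, minkowski; cbn [x1 x2 x3 x4 fst snd].
fold (x1 p) (x2 p) (x3 p) (x4 p) (x1 q) (x2 q) (x3 q) (x4 q).
transitivity ((x1 p * x1 q + x2 p * x2 q) *
  (sin (alpha * v) * sin (alpha * v) + cos (alpha * v) * cos (alpha * v)) +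
  (x3 p * x3 q - x4 p * x4 q) * (cosh (beta * v) ^ 2 - sinh (beta * v) ^ 2));
  [ring | rewrite hc, ht; ring].
Qed.

Lemma moore_rotation_plus (alpha beta v : R) (p q : R4) :
  moore_rotation alpha beta v (plus p q) =
  plus (moore_rotation alpha beta v p) (moore_rotation alpha beta v q).
Proof. unfold moore_rotation; R4_ring. Qed.

Lemma moore_rotation_scal (alpha beta v : R) (k : R) (p : R4) :
  moore_rotation alpha beta v (scal k p) = scal k (moore_rotation alpha beta v p).
Proof. unfold moore_rotation; R4_ring. Qed.

Lemma moore_rotation_opp (alpha beta v : R) (p : R4) :
  moore_rotation alpha beta v (opp p) = opp (moore_rotation alpha beta v p).
Proof. unfold moore_rotation; R4_ring. Qed.

Lemma moore_rotation_zero (alpha beta v : R) : moore_rotation alpha beta v zero = zero.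
Proof. unfold moore_rotation; R4_ring. Qed.

(** An isometry of a nondegenerate form is injective: [p] is orthogonal to every vector, and testing
    it on the standard basis reads off its coordinates. *)
Lemma moore_rotation_eq0 (alpha beta v : R) (p : R4) :
  moore_rotation alpha beta v p = zero -> p = zero.
Proof.
intros h.
assert (hq : forall q, minkowski p q = 0).
{ intros q; rewrite <- (moore_rotation_isometry alpha beta v), h.
  unfold minkowski; R4_coords; ring. }
pose proof (hq (1, 0, 0, 0)) as h1; pose proof (hq (0, 1, 0, 0)) as h2.
pose proof (hq (0, 0, 1, 0)) as h3; pose proof (hq (0, 0, 0, 1)) as h4.
unfold minkowski, x1, x2, x3, x4 in h1, h2, h3, h4; simpl in h1, h2, h3, h4.
apply R4_ext; R4_coords; unfold x1, x2, x3, x4; lra.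
Qed.

(** At fixed [v] the rotation is a linear map with constant coefficients, so it commutes with the
    derivative in [u]. *)
Lemma partial_moore_rotation_u (alpha beta : R) (p : R -> R4) (q : R4) (u v : R) :
  is_derive (fun s => x1 (p s)) u (x1 q) -> is_derive (fun s => x2 (p s)) u (x2 q) ->
  is_derive (fun s => x3 (p s)) u (x3 q) -> is_derive (fun s => x4 (p s)) u (x4 q) ->
  partial_u (fun s t => moore_rotation alpha beta t (p s)) u v =
  moore_rotation alpha beta v q.
Proof.
assert (lin : forall (h k : R -> R) (dh dk c d : R),
  is_derive h u dh -> is_derive k u dk ->
  Derive (fun s => h s * c + k s * d) u = dh * c + dk * d).
{ intros h k dh dk c d hh hk; apply is_derive_unique.
  exact (is_derive_plus _ _ _ _ _
    (is_derive_scal_l (V := R_NormedModule) h u dh c hh)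
    (is_derive_scal_l (V := R_NormedModule) k u dk d hk)). }
intros h1 h2 h3 h4; unfold partial_u, moore_rotation; cbn [x1 x2 x3 x4 fst snd].
rewrite <- (lin _ _ _ _ (sin (alpha * v)) (cos (alpha * v)) h1 h2).
rewrite <- (lin _ _ _ _ (cosh (beta * v)) (sinh (beta * v)) h3 h4).
rewrite <- (lin _ _ _ _ (sinh (beta * v)) (cosh (beta * v)) h3 h4).
unfold Rminus; rewrite !Ropp_mult_distr_r.
rewrite <- (lin _ _ _ _ (cos (alpha * v)) (- sin (alpha * v)) h1 h2).
f_equal; f_equal; f_equal; apply Derive_ext; intros s; ring.
Qed.

(** The vector on the right, before rotation, is the infinitesimal generator of the group applied to
    [p u]; the generator commutes with the group. *)
Lemma partial_moore_rotation_v (alpha beta : R) (p : R -> R4) (u v : R) :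
  partial_v (fun s t => moore_rotation alpha beta t (p s)) u v =
  moore_rotation alpha beta v
    (- (alpha * x2 (p u)), alpha * x1 (p u), beta * x4 (p u), beta * x3 (p u)).
Proof.
unfold partial_v, moore_rotation; cbn [x1 x2 x3 x4 fst snd].
generalize (x1 (p u)) (x2 (p u)) (x3 (p u)) (x4 (p u)); intros a b c d.
unfold cosh, sinh.
f_equal; [f_equal; [f_equal |] |]; apply is_derive_unique; auto_derive; trivial; field.
Qed.

Lemma partial_u_ext (z z' : R -> R -> R4) (u v : R) :
  (forall s t, z s t = z' s t) -> partial_u z u v = partial_u z' u v.
Proof.
intros h; unfold partial_u.
f_equal; [f_equal; [f_equal |] |]; apply Derive_ext; intros s; rewrite h; reflexivity.
Qed.

Lemma partial_v_ext (z z' : R -> R -> R4) (u v : R) :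
  (forall s t, z s t = z' s t) -> partial_v z u v = partial_v z' u v.
Proof.
intros h; unfold partial_v.
f_equal; [f_equal; [f_equal |] |]; apply Derive_ext; intros s; rewrite h; reflexivity.
Qed.

(** * Derivatives of the surface *)

Lemma moore_surface_rotation (alpha beta : R) (f g : R -> R) (u v : R) :
  moore_surface alpha beta f g u v = moore_rotation alpha beta v (f u, 0, 0, g u).
Proof. unfold moore_surface, moore_rotation; R4_ring. Qed.

Lemma partial_u_moore (alpha beta : R) (f g : R -> R) (u v : R) :
  partial_u (moore_surface alpha beta f g) u v =
  moore_rotation alpha beta v (Derive f u, 0, 0, Derive g u).
Proof.
unfold partial_u, moore_surface, moore_rotation; cbn [x1 x2 x3 x4 fst snd].
rewrite !Derive_scal_l; R4_ring.
Qed.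

Lemma partial_v_moore (alpha beta : R) (f g : R -> R) (u v : R) :
  partial_v (moore_surface alpha beta f g) u v =
  moore_rotation alpha beta v (0, alpha * f u, beta * g u, 0).
Proof.
rewrite (partial_v_ext _ _ _ _ (moore_surface_rotation alpha beta f g)).
rewrite (partial_moore_rotation_v _ _ (fun s => (f s, 0, 0, g s))).
f_equal; R4_ring.
Qed.

Lemma tangent_moore (alpha beta : R) (f g : R -> R) (X : R * R) (u v : R) :
  tangent (moore_surface alpha beta f g) X u v =
  moore_rotation alpha beta v
    (fst X * Derive f u, snd X * alpha * f u, snd X * beta * g u, fst X * Derive g u).
Proof.
unfold tangent; rewrite partial_u_moore, partial_v_moore.
rewrite <- !moore_rotation_scal, <- moore_rotation_plus; f_equal; R4_ring.
Qed.

(** A tangent field with constant coordinates is itself a rotated curve depending on [u] alone.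
    Hence the [u]-derivative differentiates that curve and the [v]-derivative applies the generator
    to it. *)
Lemma flat_derivative_moore (alpha beta : R) (f g : R -> R) (X Y : R * R) (u v : R) :
  ex_derive f u -> ex_derive g u -> ex_derive (Derive f) u -> ex_derive (Derive g) u ->
  flat_derivative (moore_surface alpha beta f g) u v X Y =
  moore_rotation alpha beta v
    (fst X * fst Y * Derive (Derive f) u - snd X * snd Y * alpha ^ 2 * f u,
     (fst X * snd Y + snd X * fst Y) * alpha * Derive f u,
     (fst X * snd Y + snd X * fst Y) * beta * Derive g u,
     fst X * fst Y * Derive (Derive g) u + snd X * snd Y * beta ^ 2 * g u).
Proof.
intros hf hg hf1 hg1; unfold flat_derivative.
rewrite (partial_u_ext _ _ _ _ (tangent_moore alpha beta f g Y)).
rewrite (partial_v_ext _ _ _ _ (tangent_moore alpha beta f g Y)).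
set (p := fun s => (fst Y * Derive f s, snd Y * alpha * f s,
                    snd Y * beta * g s, fst Y * Derive g s)).
rewrite (partial_moore_rotation_v _ _ p).
rewrite (partial_moore_rotation_u _ _ p
  (fst Y * Derive (Derive f) u, snd Y * alpha * Derive f u,
   snd Y * beta * Derive g u, fst Y * Derive (Derive g) u));
  try (apply is_derive_scal, Derive_correct; assumption).
rewrite <- !moore_rotation_scal, <- moore_rotation_plus; f_equal.
unfold p; R4_ring.
Qed.

(** * Fundamental forms and mean curvature *)

Lemma coefE_moore (alpha beta : R) (f g : R -> R) (u v : R) :
  coefE (moore_surface alpha beta f g) u v = Derive f u ^ 2 - Derive g u ^ 2.
Proof.
unfold coefE; rewrite partial_u_moore, moore_rotation_isometry.
unfold minkowski; cbn [x1 x2 x3 x4 fst snd]; ring.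
Qed.

Lemma coefF_moore (alpha beta : R) (f g : R -> R) (u v : R) :
  coefF (moore_surface alpha beta f g) u v = 0.
Proof.
unfold coefF; rewrite partial_u_moore, partial_v_moore, moore_rotation_isometry.
unfold minkowski; cbn [x1 x2 x3 x4 fst snd]; ring.
Qed.

Lemma coefG_moore (alpha beta : R) (f g : R -> R) (u v : R) :
  coefG (moore_surface alpha beta f g) u v = alpha ^ 2 * f u ^ 2 + beta ^ 2 * g u ^ 2.
Proof.
unfold coefG; rewrite partial_v_moore, moore_rotation_isometry.
unfold minkowski; cbn [x1 x2 x3 x4 fst snd]; ring.
Qed.

(** A vector of the rotated meridian plane is orthogonal to [z_v], so only its part along [z_u] is
    removed. What is left lies along the normal [(g', 0, 0, f')], whose square is [- E]; this is
    where the denominator of [k] comes from. *)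
Lemma normal_component_moore_radial (alpha beta : R) (f g : R -> R) (u v p q : R) :
  let E := Derive f u ^ 2 - Derive g u ^ 2 in
  let k := (q * Derive f u - p * Derive g u) / E in
  E <> 0 -> alpha ^ 2 * f u ^ 2 + beta ^ 2 * g u ^ 2 <> 0 ->
  normal_component (moore_surface alpha beta f g) u v
    (moore_rotation alpha beta v (p, 0, 0, q)) =
  moore_rotation alpha beta v (k * Derive g u, 0, 0, k * Derive f u).
Proof.
intros E k hE hG; unfold normal_component.
rewrite coefE_moore, coefF_moore, coefG_moore, partial_u_moore, partial_v_moore.
rewrite !moore_rotation_isometry, tangent_moore.
unfold minus; rewrite <- moore_rotation_opp, <- moore_rotation_plus; f_equal.
unfold minkowski; apply R4_ext; R4_coords; unfold k, E in *; field;
  rewrite ?Rpow_mult_distr; auto.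
Qed.

(* Right inverses of 2x2 matrices are left inverses: the three hypotheses say
   [M diag(E, G) M^T = diag(-1, 1)] with [M = [[a, b], [c, d]]]. *)
Lemma gram_inverse (E G a b c d : R) :
  E * a ^ 2 + G * b ^ 2 = -1 -> E * a * c + G * b * d = 0 ->
  E * c ^ 2 + G * d ^ 2 = 1 ->
  E * (c ^ 2 - a ^ 2) = 1 /\ G * (d ^ 2 - b ^ 2) = 1 /\ c * d = a * b.
Proof.
intros h1 h2 h3.
assert (hdet : a * d - b * c <> 0).
{ intros h0.
  (* This is the determinant of the matrix identity. *)
  assert (e : (a * d - b * c) ^ 2 * (E * G) = -1).
  { transitivity ((E * a ^ 2 + G * b ^ 2) * (E * c ^ 2 + G * d ^ 2) -
                  (E * a * c + G * b * d) ^ 2);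
      [ring | rewrite h1, h2, h3; ring]. }
  rewrite h0 in e; lra. }
assert (cramer : forall p q, a * p + b * q = 0 -> c * p + d * q = 0 -> p = 0 /\ q = 0).
{ intros p q hp hq.
  split; apply (Rmult_eq_reg_l (a * d - b * c)); trivial; rewrite Rmult_0_r.
  - transitivity (d * (a * p + b * q) - b * (c * p + d * q));
      [ring | rewrite hp, hq; ring].
  - transitivity (a * (c * p + d * q) - c * (a * p + b * q));
      [ring | rewrite hp, hq; ring]. }
(* With [N = diag(E, G) M^T diag(-1, 1)] one has [M N = I], so [M] annihilates both columns of
   [N M - I]. The first column is treated here, the second one below. *)
destruct (cramer (E * (c ^ 2 - a ^ 2) - 1) (G * (c * d - a * b))) as [hE hG].
- transitivity (c * (E * a * c + G * b * d) - a * (E * a ^ 2 + G * b ^ 2) - a);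
    [ring | rewrite h1, h2; ring].
- transitivity (c * (E * c ^ 2 + G * d ^ 2) - a * (E * a * c + G * b * d) - c);
    [ring | rewrite h2, h3; ring].
- destruct (cramer (E * (c * d - a * b)) (G * (d ^ 2 - b ^ 2) - 1)) as [hE' hG'].
  + transitivity (d * (E * a * c + G * b * d) - b * (E * a ^ 2 + G * b ^ 2) - b);
      [ring | rewrite h1, h2; ring].
  + transitivity (d * (E * c ^ 2 + G * d ^ 2) - b * (E * a * c + G * b * d) - d);
      [ring | rewrite h2, h3; ring].
  + split; [lra | split; [lra |]].
    assert (E <> 0) by (intros e; rewrite e in hE; lra).
    destruct (Rmult_integral _ _ hE'); lra.
Qed.

Lemma orthonormal_frame_moore (alpha beta : R) (f g : R -> R) (u v : R) (X Y : R * R) :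
  let E := Derive f u ^ 2 - Derive g u ^ 2 in
  let G := alpha ^ 2 * f u ^ 2 + beta ^ 2 * g u ^ 2 in
  orthonormal_frame (moore_surface alpha beta f g) u v X Y <->
  E * fst X ^ 2 + G * snd X ^ 2 = -1 /\
  E * fst X * fst Y + G * snd X * snd Y = 0 /\
  E * fst Y ^ 2 + G * snd Y ^ 2 = 1.
Proof.
intros E G; unfold orthonormal_frame.
assert (e : forall V W : R * R,
  minkowski (tangent (moore_surface alpha beta f g) V u v)
            (tangent (moore_surface alpha beta f g) W u v) =
  E * fst V * fst W + G * snd V * snd W).
{ intros V W; rewrite !tangent_moore, moore_rotation_isometry.
  unfold minkowski, E, G; cbn [x1 x2 x3 x4 fst snd]; ring. }
rewrite !e, <- !Rsqr_pow2; unfold Rsqr; rewrite !Rmult_assoc; tauto.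
Qed.

(** The coefficient of [H] along the rotated normal [(g', 0, 0, f')], which is not normalized: half
    of the [k] of [normal_component_moore_radial] for the trace [z_uu / E + z_vv / G]. *)
Definition moore_curvature (alpha beta : R) (f g : R -> R) (u : R) : R :=
  let E := Derive f u ^ 2 - Derive g u ^ 2 in
  let G := alpha ^ 2 * f u ^ 2 + beta ^ 2 * g u ^ 2 in
  1 / 2 * (((Derive (Derive g) u / E + beta ^ 2 * g u / G) * Derive f u -
            (Derive (Derive f) u / E - alpha ^ 2 * f u / G) * Derive g u) / E).

(** By [gram_inverse] the frame enters only through [1 / E] and [1 / G], so every orthonormal frame
    yields the same vector; normalizing [z_u] and [z_v] shows that a frame exists. *)
Lemma mean_curvature_moore (alpha beta : R) (f g : R -> R) (u v : R) (H : R4) :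
  ex_derive f u -> ex_derive g u -> ex_derive (Derive f) u -> ex_derive (Derive g) u ->
  Derive f u ^ 2 - Derive g u ^ 2 < 0 ->
  0 < alpha ^ 2 * f u ^ 2 + beta ^ 2 * g u ^ 2 ->
  is_mean_curvature_vector (moore_surface alpha beta f g) u v H <->
  H = moore_rotation alpha beta v
        (moore_curvature alpha beta f g u * Derive g u, 0, 0,
         moore_curvature alpha beta f g u * Derive f u).
Proof.
intros hf hg hf1 hg1 hE hG.
assert (trace : forall X Y : R * R,
  orthonormal_frame (moore_surface alpha beta f g) u v X Y ->
  scal (1 / 2) (plus (opp (second_fundamental (moore_surface alpha beta f g) u v X X))
                     (second_fundamental (moore_surface alpha beta f g) u v Y Y)) =
  moore_rotation alpha beta v
    (moore_curvature alpha beta f g u * Derive g u, 0, 0,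
     moore_curvature alpha beta f g u * Derive f u)).
{ intros [a b] [c d] hXY; apply orthonormal_frame_moore in hXY.
  cbn [fst snd] in hXY; destruct hXY as [h1 [h2 h3]].
  destruct (gram_inverse _ _ _ _ _ _ h1 h2 h3) as [hE' [hG' hF']].
  unfold second_fundamental.
  rewrite <- normal_component_opp, <- normal_component_plus, !flat_derivative_moore by trivial.
  rewrite <- moore_rotation_opp, <- moore_rotation_plus; cbn [fst snd].
  unfold moore_curvature.
  revert hE hG h1 h2 h3 hE' hG'.
  set (E := Derive f u ^ 2 - Derive g u ^ 2).
  set (G := alpha ^ 2 * f u ^ 2 + beta ^ 2 * g u ^ 2).
  intros hE hG h1 h2 h3 hE' hG'.
  assert (hE1 : / E = c ^ 2 - a ^ 2)
    by (apply (Rmult_eq_reg_l E); [rewrite hE'; apply Rinv_r |]; lra).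
  assert (hG1 : / G = d ^ 2 - b ^ 2)
    by (apply (Rmult_eq_reg_l G); [rewrite hG'; apply Rinv_r |]; lra).
  (* The coefficients of [z_uu] and [z_vv] are [c ^ 2 - a ^ 2 = 1 / E] and [d ^ 2 - b ^ 2 = 1 / G];
     the mixed terms carry the factor [c * d - a * b = 0]. *)
  match goal with |- context [normal_component _ _ _ (moore_rotation _ _ _ ?p)] =>
    replace p with
      (Derive (Derive f) u / E - alpha ^ 2 * f u / G, 0, 0,
       Derive (Derive g) u / E + beta ^ 2 * g u / G) end.
  2: { unfold Rdiv; rewrite hE1, hG1; apply R4_ext; R4_coords; try ring;
       [transitivity (2 * alpha * Derive f u * (c * d - a * b)) |
        transitivity (2 * beta * Derive g u * (c * d - a * b))];
       try ring; rewrite hF'; ring. }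
  rewrite normal_component_moore_radial; [| fold E; lra | fold G; lra].
  rewrite <- moore_rotation_scal; apply f_equal; fold E; R4_ring. }
split.
- intros [X [Y [hXY ->]]]; apply trace, hXY.
- intros ->.
  set (E := Derive f u ^ 2 - Derive g u ^ 2) in *.
  set (G := alpha ^ 2 * f u ^ 2 + beta ^ 2 * g u ^ 2) in *.
  assert (hXY : orthonormal_frame (moore_surface alpha beta f g) u v
                  (/ sqrt (- E), 0) (0, / sqrt G)).
  { assert (sE : sqrt (- E) ^ 2 = - E) by (apply pow2_sqrt; lra).
    assert (sG : sqrt G ^ 2 = G) by (apply pow2_sqrt; lra).
    apply orthonormal_frame_moore; fold E G; cbn [fst snd]; rewrite !pow_inv, sE, sG.
    split; [field; lra | split; [ring | field; lra]]. }
  exists (/ sqrt (- E), 0), (0, / sqrt G); split; [exact hXY | symmetry; apply trace, hXY].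
Qed.

Lemma mean_curvature_moore_eq0 (alpha beta : R) (f g : R -> R) (u v : R) :
  ex_derive f u -> ex_derive g u -> ex_derive (Derive f) u -> ex_derive (Derive g) u ->
  Derive f u ^ 2 - Derive g u ^ 2 < 0 ->
  0 < alpha ^ 2 * f u ^ 2 + beta ^ 2 * g u ^ 2 ->
  is_mean_curvature_vector (moore_surface alpha beta f g) u v zero <->
  (Derive (Derive f) u * Derive g u - Derive (Derive g) u * Derive f u) *
    (alpha ^ 2 * f u ^ 2 + beta ^ 2 * g u ^ 2) =
  (Derive f u ^ 2 - Derive g u ^ 2) *
    (alpha ^ 2 * f u * Derive g u + beta ^ 2 * g u * Derive f u).
Proof.
intros hf hg hf1 hg1 hE hG; rewrite mean_curvature_moore by trivial.
(* The defect of the equation is [-2 E^2 G] times the curvature coefficient, and this factor does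
   not vanish. *)
assert (hk : (Derive (Derive f) u * Derive g u - Derive (Derive g) u * Derive f u) *
    (alpha ^ 2 * f u ^ 2 + beta ^ 2 * g u ^ 2) -
  (Derive f u ^ 2 - Derive g u ^ 2) *
    (alpha ^ 2 * f u * Derive g u + beta ^ 2 * g u * Derive f u) =
  - 2 * (Derive f u ^ 2 - Derive g u ^ 2) ^ 2 *
    (alpha ^ 2 * f u ^ 2 + beta ^ 2 * g u ^ 2) * moore_curvature alpha beta f g u).
{ unfold moore_curvature; field; lra. }
split.
- intros h; symmetry in h; apply moore_rotation_eq0 in h.
  (* The first coordinate suffices, because [f'^2 < g'^2] forces [Derive g u] to be nonzero. *)
  apply (f_equal x1) in h; cbn [x1 fst snd] in h.
  change (moore_curvature alpha beta f g u * Derive g u = 0) in h.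
  destruct (Rmult_integral _ _ h) as [h0 | h0].
  + rewrite h0 in hk; lra.
  + rewrite h0 in hE; pose proof (pow2_ge_0 (Derive f u)); lra.
- intros h.
  assert (h0 : moore_curvature alpha beta f g u = 0).
  { assert (0 < (Derive f u ^ 2 - Derive g u ^ 2) ^ 2) by (apply pow2_gt_0; lra).
    apply (Rmult_eq_reg_l ((Derive f u ^ 2 - Derive g u ^ 2) ^ 2 *
      (alpha ^ 2 * f u ^ 2 + beta ^ 2 * g u ^ 2))); [lra |].
    apply Rgt_not_eq, Rmult_lt_0_compat; assumption. }
  rewrite h0, !Rmult_0_l; symmetry; exact (moore_rotation_zero alpha beta v).
Qed.

(** * Preliminaries from real analysis *)

(** Since [sin (acos y) = Rabs x], the sign of [x] decides between [acos y] and its opposite. *)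
Lemma exists_angle (x y : R) : x ^ 2 + y ^ 2 = 1 -> exists C : R, sin C = x /\ cos C = y.
Proof.
intros h.
assert (hy : -1 <= y <= 1) by (pose proof (pow2_ge_0 x); split; nra).
assert (hs : sin (acos y) = Rabs x).
{ rewrite sin_acos by exact hy.
  replace (1 - Rsqr y) with (Rsqr x) by (unfold Rsqr; lra); apply sqrt_Rsqr_abs. }
destruct (Rle_lt_dec 0 x) as [hx | hx].
- exists (acos y); rewrite hs, cos_acos, Rabs_pos_eq; auto.
- exists (- acos y); rewrite sin_neg, cos_neg, hs, cos_acos, Rabs_left; auto with real.
Qed.

Lemma Rbar_interval_locally (a b : Rbar) (u : R) :
  Rbar_open_interval a b u -> locally u (Rbar_open_interval a b).
Proof.
apply (locally_open (Rbar_open_interval a b)); trivial.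
apply open_and; [apply open_Rbar_gt | apply open_Rbar_lt].
Qed.

Lemma Rbar_interval_const (a b : Rbar) (h : R -> R) :
  (forall u, Rbar_open_interval a b u -> is_derive h u 0) ->
  forall u w, Rbar_open_interval a b u -> Rbar_open_interval a b w -> h u = h w.
Proof.
intros hd.
assert (key : forall u w, Rbar_open_interval a b u -> Rbar_open_interval a b w ->
  u < w -> h u = h w).
{ intros u w [hu _] [_ hw] huw; apply eq_is_derive; trivial.
  intros t ht; apply hd; split.
  - apply (Rbar_lt_le_trans _ u); [exact hu | exact (proj1 ht)].
  - apply (Rbar_le_lt_trans _ w); [exact (proj2 ht) | exact hw]. }
intros u w hu hw; destruct (Rtotal_order u w) as [h1 | [-> | h1]];
  [apply key | | symmetry; apply key]; trivial.
Qed.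

(** The root exceeds [Rabs x], which is at least [- x]. This fixes the sign of the argument of the
    logarithm in the meridian formula. *)
Lemma add_sqrt_pos (A x : R) : 0 < A -> 0 < x + sqrt (x ^ 2 + A).
Proof.
intros hA; pose proof (sqrt_lt_1 (x ^ 2) (x ^ 2 + A)) as h.
replace (sqrt (x ^ 2)) with (Rabs x) in h by (rewrite <- sqrt_Rsqr_abs; f_equal; unfold Rsqr; ring).
pose proof (pow2_ge_0 x); pose proof (Rle_abs (- x)) as h'; rewrite Rabs_Ropp in h'.
lra.
Qed.

Lemma sqr_add_pos (A beta y : R) : 0 < A -> 0 < beta ^ 2 * y ^ 2 + A.
Proof.
intros hA; rewrite <- Rpow_mult_distr; pose proof (pow2_ge_0 (beta * y)); lra.
Qed.

Lemma is_derive_sqrt_sqr_add (A beta : R) (g : R -> R) (u dg : R) :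
  0 < A -> is_derive g u dg ->
  is_derive (fun s => sqrt (beta ^ 2 * g s ^ 2 + A)) u
    (beta ^ 2 * g u * dg / sqrt (beta ^ 2 * g u ^ 2 + A)).
Proof.
intros hA hg; pose proof (sqr_add_pos A beta (g u) hA) as hpos.
pose proof (sqrt_lt_R0 _ hpos) as hw.
set (w := sqrt (beta ^ 2 * g u ^ 2 + A)) in *.
replace (beta ^ 2 * g u * dg / w) with ((2 * (beta ^ 2 * g u * dg)) / (2 * w))
  by (field; lra).
apply is_derive_sqrt; [| exact hpos].
auto_derive; [exists dg; exact hg |].
rewrite (is_derive_unique (fun x : R => g x) u dg hg); ring.
Qed.

(** Up to an additive constant the function is the inverse hyperbolic sine of
    [beta * g / sqrt A]. *)
Lemma is_derive_ln_add_sqrt (A beta : R) (g : R -> R) (u dg : R) :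
  0 < A -> is_derive g u dg ->
  is_derive (fun s => ln (Rabs (beta * g s + sqrt (beta ^ 2 * g s ^ 2 + A)))) u
    (beta * dg / sqrt (beta ^ 2 * g u ^ 2 + A)).
Proof.
intros hA hg.
assert (hpos : forall s, 0 < beta * g s + sqrt (beta ^ 2 * g s ^ 2 + A)).
{ intros s; rewrite <- Rpow_mult_distr; apply add_sqrt_pos, hA. }
apply (is_derive_ext (fun s => ln (beta * g s + sqrt (beta ^ 2 * g s ^ 2 + A)))).
{ intros s; rewrite Rabs_pos_eq by (apply Rlt_le, hpos); reflexivity. }
pose proof (sqr_add_pos A beta (g u) hA) as hw.
pose proof (sqrt_lt_R0 _ hw) as hw0.
auto_derive.
- repeat split; [exists dg; exact hg | exists dg; exact hg | |].
  + replace (beta * (beta * 1) * (g u * (g u * 1)) + A) with (beta ^ 2 * g u ^ 2 + A) by ring.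
    exact hw.
  + replace (beta * (beta * 1) * (g u * (g u * 1)) + A) with (beta ^ 2 * g u ^ 2 + A) by ring.
    apply hpos.
- rewrite (is_derive_unique (fun x : R => g x) u dg hg).
  replace (beta * (beta * 1) * (g u * (g u * 1)) + A) with (beta ^ 2 * g u ^ 2 + A) by ring.
  field; split; [lra | specialize (hpos u); lra].
Qed.

(* In both directions [w] is [sqrt (beta ^ 2 * y ^ 2 + A)]; the first equation is
   then the first integral
   [A = (beta^2 g^2 f'^2 + alpha^2 f^2 g'^2) / (g'^2 - f'^2)]. *)
Lemma moore_ode_iff (alpha beta x p p' y q q' w : R) :
  w ^ 2 * (q ^ 2 - p ^ 2) = (alpha ^ 2 * x ^ 2 + beta ^ 2 * y ^ 2) * q ^ 2 ->
  p ^ 2 - q ^ 2 < 0 -> w <> 0 ->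
  (p' * q - q' * p) * (alpha ^ 2 * x ^ 2 + beta ^ 2 * y ^ 2) =
    (p ^ 2 - q ^ 2) * (alpha ^ 2 * x * q + beta ^ 2 * y * p) <->
  (p' * q - q' * p) * w ^ 2 = - q ^ 2 * (alpha ^ 2 * x * q + beta ^ 2 * y * p).
Proof.
intros hw hpq hw0.
assert (hq : 0 < q ^ 2) by (pose proof (pow2_ge_0 p); lra).
assert (hw2 : 0 < w ^ 2) by (apply pow2_gt_0, hw0).
set (G := alpha ^ 2 * x ^ 2 + beta ^ 2 * y ^ 2) in *.
set (K := alpha ^ 2 * x * q + beta ^ 2 * y * p); set (L := p' * q - q' * p).
(* Multiplying by a positive factor lets [hw] exchange [w ^ 2 * (q ^ 2 - p ^ 2)] for [G * q ^ 2]. *)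
split; intros h.
- apply (Rmult_eq_reg_r (q ^ 2 - p ^ 2)); [| lra].
  transitivity (L * (w ^ 2 * (q ^ 2 - p ^ 2))); [ring | rewrite hw].
  transitivity (L * G * q ^ 2); [ring | rewrite h; ring].
- apply (Rmult_eq_reg_r (q ^ 2)); [| lra].
  transitivity (L * (G * q ^ 2)); [ring | rewrite <- hw].
  transitivity (L * w ^ 2 * (q ^ 2 - p ^ 2)); [ring | rewrite h; ring].
Qed.

(** * The meridian equation and its solutions *)

Section MooreProfile.

Context (alpha beta : R) (a b : Rbar) (f g f1 g1 f2 g2 : R -> R)
  (ha : 0 < alpha) (hb : 0 < beta).
Let J := Rbar_open_interval a b.
Context
  (hf : forall u, J u -> is_derive f u (f1 u)) (hf1 : forall u, J u -> is_derive f1 u (f2 u))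
  (hg : forall u, J u -> is_derive g u (g1 u)) (hg1 : forall u, J u -> is_derive g1 u (g2 u))
  (hE : forall u, J u -> f1 u ^ 2 - g1 u ^ 2 < 0).

(** The equation [H = 0] with denominators cleared, as in [mean_curvature_moore_eq0]. *)
Let ODE u := (f2 u * g1 u - g2 u * f1 u) * (alpha ^ 2 * f u ^ 2 + beta ^ 2 * g u ^ 2) =
  (f1 u ^ 2 - g1 u ^ 2) * (alpha ^ 2 * f u * g1 u + beta ^ 2 * g u * f1 u).

(** [auto_derive] leaves eta-expanded [Derive] terms; the rewrites turn them into [f1], [g1], [f2],
    [g2]. *)
Ltac derivs u hu :=
  auto_derive; [repeat split; trivial; try (eexists; auto; fail) |
  rewrite ?(is_derive_unique (fun x : R => f x) u _ (hf u hu)),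
    ?(is_derive_unique (fun x : R => g x) u _ (hg u hu)),
    ?(is_derive_unique (fun x : R => f1 x) u _ (hf1 u hu)),
    ?(is_derive_unique (fun x : R => g1 x) u _ (hg1 u hu))].

Lemma moore_first_integral_const : (forall u, J u -> ODE u) ->
  forall u, J u ->
  is_derive (fun u => (beta ^ 2 * g u ^ 2 * f1 u ^ 2 + alpha ^ 2 * f u ^ 2 * g1 u ^ 2) /
                      (g1 u ^ 2 - f1 u ^ 2)) u 0.
Proof.
intros ho u hu; specialize (ho u hu); red in ho; pose proof (hE u hu).
derivs u hu.
- lra.
(* The derivative is a multiple of the defect of [ODE]. The factor [f1 u] means that constancy alone
   says nothing where [f1] vanishes, so [ODE] is used again when solving. *)
- match goal with |- ?d = 0 => transitivity (2 * f1 u * g1 u *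
   ((f2 u * g1 u - g2 u * f1 u) * (alpha ^ 2 * f u ^ 2 + beta ^ 2 * g u ^ 2) -
  (f1 u ^ 2 - g1 u ^ 2) * (alpha ^ 2 * f u * g1 u + beta ^ 2 * g u * f1 u))
    / (g1 u ^ 2 - f1 u ^ 2) ^ 2) end.
  + field; lra.
  + rewrite ho; field; lra.
Qed.

Lemma moore_profile_of_ode : (forall u, J u -> ODE u) -> (exists u, J u /\ f u <> 0) ->
  exists A C : R, 0 < A /\
    forall u, J u ->
      f u = sqrt A / alpha *
            sin (alpha / beta *
                   ln (Rabs (beta * g u + sqrt (beta ^ 2 * g u ^ 2 + A))) + C).
Proof.
intros ho [u0 [hu0 hfu0]].
set (I u := (beta ^ 2 * g u ^ 2 * f1 u ^ 2 + alpha ^ 2 * f u ^ 2 * g1 u ^ 2) /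
                      (g1 u ^ 2 - f1 u ^ 2)).
(* The base point has [f u0 <> 0], which makes the first integral positive. *)
set (A := I u0).
assert (hA : 0 < A).
{ pose proof (hE u0 hu0).
  assert (0 < g1 u0 ^ 2) by (pose proof (pow2_ge_0 (f1 u0)); lra).
  apply Rdiv_lt_0_compat; [| lra].
  apply Rplus_le_lt_0_compat.
  - rewrite <- !Rpow_mult_distr; apply pow2_ge_0.
  - rewrite <- Rpow_mult_distr; apply Rmult_lt_0_compat; trivial.
    apply pow2_gt_0, Rmult_integral_contrapositive; split; lra. }
assert (hAu : forall u, J u -> A * (g1 u ^ 2 - f1 u ^ 2) =
    beta ^ 2 * g u ^ 2 * f1 u ^ 2 + alpha ^ 2 * f u ^ 2 * g1 u ^ 2).
{ intros u hu; pose proof (hE u hu).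
  replace A with (I u).
  - unfold I; field; lra.
  - exact (Rbar_interval_const a b I (moore_first_integral_const ho) u u0 hu hu0). }
set (w u := sqrt (beta ^ 2 * g u ^ 2 + A)).
assert (hw0 : forall u, 0 < beta ^ 2 * g u ^ 2 + A) by (intros u; apply sqr_add_pos, hA).
assert (hw : forall u, 0 < w u) by (intros u; apply sqrt_lt_R0, hw0).
assert (hw2 : forall u, w u ^ 2 = beta ^ 2 * g u ^ 2 + A)
  by (intros u; apply pow2_sqrt, Rlt_le, hw0).
assert (hdw : forall u, J u -> is_derive w u (beta ^ 2 * g u * g1 u / w u)).
{ intros u hu; apply is_derive_sqrt_sqr_add; auto. }
set (t u := alpha / beta * ln (Rabs (beta * g u + w u))).
assert (hdt : forall u, J u -> is_derive t u (alpha * g1 u / w u)).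
{ intros u hu.
  replace (alpha * g1 u / w u) with (alpha / beta * (beta * g1 u / w u))
    by (field; specialize (hw u); lra).
  apply is_derive_scal, is_derive_ln_add_sqrt; auto. }
assert (hg0 : forall u, J u -> g1 u <> 0).
{ intros u hu e; pose proof (hE u hu) as h; rewrite e in h.
  pose proof (pow2_ge_0 (f1 u)); lra. }
(* [(alpha * f, P)] runs on a circle of radius [sqrt A] at angular speed [t']. *)
set (P u := f1 u * w u / g1 u).
assert (hdP : forall u, J u -> is_derive P u (- (alpha * f u) * (alpha * g1 u / w u))).
{ intros u hu.
  assert (hK : (f2 u * g1 u - g2 u * f1 u) * w u ^ 2 =
    - g1 u ^ 2 * (alpha ^ 2 * f u * g1 u + beta ^ 2 * g u * f1 u)).
  { apply moore_ode_iff; [| apply hE, hu | specialize (hw u); lra | apply ho, hu].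
    rewrite hw2; specialize (hAu u hu); lra. }
  replace (- (alpha * f u) * (alpha * g1 u / w u)) with
    (((f2 u * g1 u - g2 u * f1 u) * w u ^ 2 + beta ^ 2 * g u * f1 u * g1 u ^ 2) /
     (g1 u ^ 2 * w u)).
  2: { rewrite hK; field; split; [specialize (hw u); lra | auto]. }
  unfold P; derivs u hu.
  - auto.
  - rewrite (is_derive_unique (fun x : R => w x) u _ (hdw u hu)).
    field; split; [specialize (hw u); lra | auto]. }
(* Multiplied by [g1 u0 ^ 2], this is the first integral at [u0]. *)
assert (hcirc : (alpha * f u0) ^ 2 + P u0 ^ 2 = A).
{ pose proof (hg0 u0 hu0) as hg0'.
  transitivity (((alpha * f u0) ^ 2 * g1 u0 ^ 2 + f1 u0 ^ 2 * w u0 ^ 2) / g1 u0 ^ 2).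
  - unfold P; field; exact hg0'.
  - replace ((alpha * f u0) ^ 2 * g1 u0 ^ 2 + f1 u0 ^ 2 * w u0 ^ 2) with (A * g1 u0 ^ 2).
    + field; exact hg0'.
    + rewrite hw2; specialize (hAu u0 hu0); lra. }
(* These undo the rotation of [(alpha * f, P)] by the angle [t]. They are constant because
   [(alpha * f)' = P * t'] and [P' = - (alpha * f) * t']; their values will be [sqrt A * sin C] and
   [sqrt A * cos C]. *)
set (c1 u := alpha * f u * cos (t u) - P u * sin (t u)).
set (c2 u := alpha * f u * sin (t u) + P u * cos (t u)).
assert (hPt : forall u, J u -> alpha * f1 u = P u * (alpha * g1 u / w u)).
{ intros u hu; unfold P; field; split; [specialize (hw u); lra | auto]. }
assert (hc1 : forall u, J u -> c1 u = c1 u0).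
{ intros u hu; refine (Rbar_interval_const a b c1 _ u u0 hu hu0); clear u hu; intros u hu.
  unfold c1; derivs u hu.
  rewrite (is_derive_unique (fun x : R => P x) u _ (hdP u hu)),
    (is_derive_unique (fun x : R => t x) u _ (hdt u hu)).
  transitivity ((alpha * f1 u - P u * (alpha * g1 u / w u)) * cos (t u)); [ring |].
  rewrite (hPt u hu); ring. }
assert (hc2 : forall u, J u -> c2 u = c2 u0).
{ intros u hu; refine (Rbar_interval_const a b c2 _ u u0 hu hu0); clear u hu; intros u hu.
  unfold c2; derivs u hu.
  rewrite (is_derive_unique (fun x : R => P x) u _ (hdP u hu)),
    (is_derive_unique (fun x : R => t x) u _ (hdt u hu)).
  transitivity ((alpha * f1 u - P u * (alpha * g1 u / w u)) * sin (t u)); [ring |].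
  rewrite (hPt u hu); ring. }
assert (hsc : forall u, sin (t u) ^ 2 + cos (t u) ^ 2 = 1).
{ intros u; rewrite <- !Rsqr_pow2; apply sin2_cos2. }
pose proof (sqrt_lt_R0 A hA) as hsA.
assert (hsA2 : sqrt A ^ 2 = A) by (apply pow2_sqrt; lra).
destruct (exists_angle (c1 u0 / sqrt A) (c2 u0 / sqrt A)) as [C [hC1 hC2]].
{ transitivity (((alpha * f u0) ^ 2 + P u0 ^ 2) * (sin (t u0) ^ 2 + cos (t u0) ^ 2) / sqrt A ^ 2).
  - unfold c1, c2; field; lra.
  - rewrite hsc, hcirc, hsA2; field; lra. }
exists A, C; split; [exact hA |]; intros u hu.
change (f u = sqrt A / alpha * sin (t u + C)).
rewrite sin_plus, hC1, hC2, <- (hc1 u hu), <- (hc2 u hu).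
transitivity (f u * (sin (t u) ^ 2 + cos (t u) ^ 2)); [rewrite hsc; ring |].
unfold c1, c2; field; lra.
Qed.

(** Two differentiations of the formula express [f1] and [f2] through the phase [phi]. The first
    integral then reduces to [sin^2 + cos^2 = 1], and in the equation the terms in [g2] cancel; the
    sign enters only through [eps ^ 2 = 1]. *)
Lemma moore_ode_of_profile (A C eps : R) : 0 < A -> eps = 1 \/ eps = -1 ->
  (forall u, J u ->
      f u = sqrt A / alpha *
            sin (eps * alpha / beta *
                   ln (Rabs (beta * g u + sqrt (beta ^ 2 * g u ^ 2 + A))) + C)) ->
  forall u, J u -> ODE u.
Proof.
intros hA heps hfu.
set (w u := sqrt (beta ^ 2 * g u ^ 2 + A)).
assert (hw0 : forall u, 0 < beta ^ 2 * g u ^ 2 + A) by (intros u; apply sqr_add_pos, hA).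
assert (hw : forall u, 0 < w u) by (intros u; apply sqrt_lt_R0, hw0).
assert (hw2 : forall u, w u ^ 2 = beta ^ 2 * g u ^ 2 + A)
  by (intros u; apply pow2_sqrt, Rlt_le, hw0).
assert (hdw : forall u, J u -> is_derive w u (beta ^ 2 * g u * g1 u / w u)).
{ intros u hu; apply is_derive_sqrt_sqr_add; auto. }
set (phi u := eps * alpha / beta * ln (Rabs (beta * g u + w u)) + C).
assert (hdphi : forall u, J u -> is_derive phi u (eps * alpha * g1 u / w u)).
{ intros u hu.
  assert (hl : is_derive (fun s => ln (Rabs (beta * g s + w s))) u (beta * g1 u / w u))
    by (apply is_derive_ln_add_sqrt; auto).
  replace (eps * alpha * g1 u / w u) with
    (plus (eps * alpha / beta * (beta * g1 u / w u)) 0).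
  - apply (is_derive_plus (fun s => _) (fun _ => C)).
    + apply is_derive_scal, hl.
    + apply (is_derive_const (V := R_NormedModule)).
  - unfold plus; simpl; field; specialize (hw u); lra. }
assert (hfphi : forall u, J u -> f u = sqrt A / alpha * sin (phi u)) by exact hfu.
assert (hf1phi : forall u, J u -> f1 u = eps * sqrt A * cos (phi u) * g1 u / w u).
{ intros u hu; rewrite <- (is_derive_unique f u _ (hf u hu)).
  apply is_derive_unique.
  (* The formula for [f] holds only on [J], so openness of [J] is what permits differentiating
     it. *)
  apply (is_derive_ext_loc (fun s => sqrt A / alpha * sin (phi s))).
  - apply (filter_imp J); [intros s hs; symmetry; auto | apply Rbar_interval_locally, hu].
  - derivs u hu.
    rewrite (is_derive_unique (fun x : R => phi x) u _ (hdphi u hu)).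
    field; specialize (hw u); lra. }
assert (hf2phi : forall u, J u -> f2 u =
  eps * sqrt A * (cos (phi u) * g2 u / w u - sin (phi u) * (eps * alpha * g1 u / w u) * g1 u / w u
    - cos (phi u) * g1 u * (beta ^ 2 * g u * g1 u / w u) / w u ^ 2)).
{ intros u hu; rewrite <- (is_derive_unique f1 u _ (hf1 u hu)).
  apply is_derive_unique.
  apply (is_derive_ext_loc (fun s => eps * sqrt A * cos (phi s) * g1 s / w s)).
  - apply (filter_imp J); [intros s hs; symmetry; auto | apply Rbar_interval_locally, hu].
  - derivs u hu.
    + specialize (hw u); lra.
    + rewrite (is_derive_unique (fun x : R => phi x) u _ (hdphi u hu)),
        (is_derive_unique (fun x : R => w x) u _ (hdw u hu)).
      field; specialize (hw u); lra. }
intros u hu; pose proof (hw u) as hwu.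
assert (hsA2 : sqrt A ^ 2 = A) by (apply pow2_sqrt; lra).
assert (heps2 : eps ^ 2 = 1) by (destruct heps as [-> | ->]; ring).
assert (hsc : sin (phi u) ^ 2 + cos (phi u) ^ 2 = 1)
  by (rewrite <- !Rsqr_pow2; apply sin2_cos2).
apply (moore_ode_iff alpha beta _ _ _ _ _ _ (w u)); [| apply hE, hu | lra |].
- transitivity (w u ^ 2 * g1 u ^ 2 - eps ^ 2 * sqrt A ^ 2 * cos (phi u) ^ 2 * g1 u ^ 2).
  { rewrite hf1phi by trivial; field; lra. }
  rewrite hfphi by trivial.
  transitivity ((sqrt A ^ 2 * sin (phi u) ^ 2 + beta ^ 2 * g u ^ 2) * g1 u ^ 2); [| field; lra].
  rewrite heps2, hsA2, hw2; replace (cos (phi u) ^ 2) with (1 - sin (phi u) ^ 2) by lra; ring.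
- rewrite hf2phi, hf1phi, hfphi by trivial.
  transitivity (- g1 u ^ 2 * (eps ^ 2 * (alpha * sqrt A * sin (phi u) * g1 u) +
    beta ^ 2 * g u * (eps * sqrt A * cos (phi u) * g1 u / w u))); [field; lra |].
  rewrite heps2; field; lra.
Qed.

End MooreProfile.

(** * Zero mean curvature and the meridian formula *)

Theorem theorem4p2 (alpha beta : R) (a b : Rbar) (f g : R -> R)
  (halpha : 0 < alpha) (hbeta : 0 < beta) (hneq : alpha <> beta)
  (hJ : Rbar_lt a b)
  (hf : smooth_on (Rbar_open_interval a b) f)
  (hg : smooth_on (Rbar_open_interval a b) g)
  (hE : forall u, Rbar_open_interval a b u -> Derive f u ^ 2 - Derive g u ^ 2 < 0)
  (hG : forall u, Rbar_open_interval a b u ->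
          alpha ^ 2 * f u ^ 2 + beta ^ 2 * g u ^ 2 > 0)
  (* f = 0 gives the plane x1 = x2 = 0, which has H = 0 but would need A = 0 *)
  (hf0 : exists u, Rbar_open_interval a b u /\ f u <> 0) :
  zero_mean_curvature
    (fun u v => Rbar_open_interval a b u /\ 0 <= v < 2 * PI)
    (moore_surface alpha beta f g)
  <->
  exists A C eps : R, 0 < A /\ (eps = 1 \/ eps = -1) /\
    forall u, Rbar_open_interval a b u ->
      f u = sqrt A / alpha *
            sin (eps * alpha / beta *
                   ln (Rabs (beta * g u + sqrt (beta ^ 2 * g u ^ 2 + A))) + C).
Proof.
set (J := Rbar_open_interval a b) in *.
(* [ex_derive_n f (S n) u] unfolds to differentiability of [Derive_n f n] at [u], so orders 1 and 2
   concern [f] and [Derive f]. *)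
assert (hf1 : forall u, J u -> ex_derive f u) by exact (hf 1%nat).
assert (hg1 : forall u, J u -> ex_derive g u) by exact (hg 1%nat).
assert (hf2 : forall u, J u -> ex_derive (Derive f) u) by exact (hf 2%nat).
assert (hg2 : forall u, J u -> ex_derive (Derive g) u) by exact (hg 2%nat).
assert (hdf : forall u, J u -> is_derive f u (Derive f u))
  by (intros; apply Derive_correct; auto).
assert (hdg : forall u, J u -> is_derive g u (Derive g u))
  by (intros; apply Derive_correct; auto).
assert (hdf1 : forall u, J u -> is_derive (Derive f) u (Derive (Derive f) u))
  by (intros; apply Derive_correct; auto).
assert (hdg1 : forall u, J u -> is_derive (Derive g) u (Derive (Derive g) u))
  by (intros; apply Derive_correct; auto).
split.
- intros hH.
  (* The equation is free of [v], so the single value [v = 0] yields it. *)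
  assert (hv : 0 <= 0 < 2 * PI) by (pose proof PI_RGT_0; lra).
  pose proof (fun u hu => proj1 (mean_curvature_moore_eq0 alpha beta f g u 0
    (hf1 u hu) (hg1 u hu) (hf2 u hu) (hg2 u hu) (hE u hu) (hG u hu))
    (hH u 0 (conj hu hv))) as hode.
  destruct (moore_profile_of_ode alpha beta a b f g _ _ _ _
    halpha hbeta hdf hdf1 hdg hdg1 hE hode hf0) as [A [C [hA hfA]]].
  (* The sign [1] reaches every solution, since [sin (- s + C) = sin (s + (PI - C))]. *)
  exists A, C, 1; split; [exact hA |]; split; [left; reflexivity |].
  intros u hu; rewrite Rmult_1_l; apply hfA, hu.
- intros [A [C [eps [hA [heps hfA]]]]] u v [hu _].
  apply mean_curvature_moore_eq0; [auto | auto | auto | auto | apply hE, hu | apply hG, hu |].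
  exact (moore_ode_of_profile alpha beta a b f g _ _ _ _
    halpha hbeta hdf hdf1 hdg hdg1 hE A C eps hA heps hfA u hu).
Qed.
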